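(* Let $\mathcal{F}$ be an infinite frieze with quiddity row $(a_i)_{i\in\mathbb{Z}}$ and let $k$ be a fixed integer. Then the sequence $(\hat a_i)_{i\in\mathbb{Z}}$ defined by $$\hat a_i=\begin{cases} a_i&\text{if }i\le k-1,\\ a_k+1&\text{if }i=k,\\ 1&\text{if }i=k+1,\\ a_{k+1}+1&\text{if }i=k+2,\\ a_{i-1}&\text{if }i\ge k+3,\end{cases}$$ is the quiddity row of an infinite frieze $\widehat{\mathcal{F}}$.
   Context: An infinite frieze is an array $(m_{ij})_{i,j\in\mathbb{Z},\,j-i\ge -2}$ of integers with $m_{i,i-2}=0$ and $m_{i,i-1}=1$ for all $i\in\mathbb{Z}$, $m_{ij}>0$ for all $j\ge i$, and $m_{ij}m_{i+1,j+1}-m_{i+1,j}m_{i,j+1}=1$ for all $j-i\ge -1$. Its quiddity row is the sequence $(a_i)_{i\in\mathbb{Z}}$ with $a_i=m_{ii}$. *)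

(* Defs.v *)
From mathcomp Require Import all_boot all_order all_algebra.

Set Implicit Arguments.
Unset Strict Implicit.
Unset Printing Implicit Defensive.

Import Order.TTheory GRing.Theory Num.Theory.
Local Open Scope ring_scope.

(* Only the entries [m i j] with [j - i >= -2] belong to the array; the values
   of the total function [m] elsewhere are junk and are not constrained. *)
Record infinite_frieze (m : int -> int -> int) : Prop := InfiniteFrieze {
  frieze_row0 : forall i : int, m i (i - 2) = 0;
  frieze_row1 : forall i : int, m i (i - 1) = 1;
  frieze_gt0 : forall i j : int, i <= j -> 0 < m i j;
  frieze_diamond : forall i j : int, -1 <= j - i ->
    m i j * m (i + 1) (j + 1) - m (i + 1) j * m i (j + 1) = 1
}.

Definition quiddity_row (m : int -> int -> int) (i : int) : int := m i i.

Definition ahat (a : int -> int) (k i : int) : int :=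
  if i <= k - 1 then a i
  else if i == k then a k + 1
  else if i == k + 1 then 1
  else if i == k + 2 then a (k + 1) + 1
  else a (i - 1).

(* Main.v *)
(** Put a vertex of an infinite polygon at each integer and let [m i j] label
    the arc from [i - 1] to [j + 1]. Oriented arcs [M u v = - M v u] make
    [M u v] behave like [det (x_u, x_v)] for plane vectors [x_u], and the
    diamond rule becomes the Plücker relation for [u, u + 1, v, v + 1]. The
    frieze with quiddity row [ahat] is obtained by inserting the vector
    [x_k + x_(k+1)] between [x_k] and [x_(k+1)], which keeps all determinants of
    consecutive vectors equal to [1]. *)

Require Import Defs.
From mathcomp Require Import all_boot all_order all_algebra.
From mathcomp Require Import zify ring.

Set Implicit Arguments.
Unset Strict Implicit.
Unset Printing Implicit Defensive.

Import Order.TTheory GRing.Theory Num.Theory.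
Local Open Scope ring_scope.

Record oriented_frieze (M : int -> int -> int) : Prop := OrientedFrieze {
  oriented_anti : forall u v : int, M v u = - M u v;
  oriented_gt0 : forall u v : int, u < v -> 0 < M u v;
  oriented_diamond : forall u v : int,
    M u v * M (u + 1) (v + 1) - M (u + 1) v * M u (v + 1) = 1
}.

(** Both branches read [m] only at entries with [j - i >= -2], so junk values never enter; [u = v]
    lands on the row of zeros. *)
Definition orient (m : int -> int -> int) (u v : int) : int :=
  if u <= v then m (u + 1) (v - 1) else - m (v + 1) (u - 1).

Definition unorient (M : int -> int -> int) (i j : int) : int :=
  M (i - 1) (j + 1).

Lemma orient_diag (m : int -> int -> int) (u : int) :
  infinite_frieze m -> orient m u u = 0.
Proof.
move=> hm; rewrite /orient lexx -(frieze_row0 hm (u + 1)).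
by congr m; lia.
Qed.

Lemma orient_succ (m : int -> int -> int) (u : int) :
  infinite_frieze m -> orient m u (u + 1) = 1.
Proof.
move=> hm; rewrite /orient ifT; last by lia.
exact: frieze_row1.
Qed.

Lemma orient_anti (m : int -> int -> int) (u v : int) :
  infinite_frieze m -> orient m v u = - orient m u v.
Proof.
move=> hm; have [-> | neq_uv] := eqVneq u v.
  by rewrite orient_diag ?oppr0.
rewrite /orient; have [le_uv | lt_vu] := leP u v.
  by rewrite ifF //; lia.
by rewrite opprK ltW.
Qed.

Lemma orient_frieze (m : int -> int -> int) :
  infinite_frieze m -> oriented_frieze (orient m).
Proof.
move=> hm; have anti u v := orient_anti u v hm.
(* [u < v] is exactly the range [-1 <= j - i] for the frieze rule at [(u + 1, v - 1)]. By
   antisymmetry the expression is unchanged when [u] and [v] are swapped, which covers [v < u]. *)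
have diamond_lt u v : u < v ->
    orient m u v * orient m (u + 1) (v + 1)
    - orient m (u + 1) v * orient m u (v + 1) = 1.
  move=> lt_uv; rewrite /orient !ifT; try lia.
  rewrite -[RHS](@frieze_diamond _ hm (u + 1) (v - 1)); last by lia.
  by rewrite addrK subrK.
split=> // [u v lt_uv | u v].
  have [-> | neq_v] := eqVneq v (u + 1); first by rewrite orient_succ.
  by rewrite /orient ltW // frieze_gt0 //; lia.
case: (ltgtP u v) => [/diamond_lt // | lt_vu | <-].
  rewrite -[RHS](diamond_lt v u lt_vu).
  by rewrite (anti v u) (anti (v + 1)) (anti v) (anti (v + 1) u); ring.
by rewrite (anti u (u + 1)) !orient_diag // orient_succ.
Qed.

Lemma oriented_diag (M : int -> int -> int) (u : int) :
  oriented_frieze M -> M u u = 0.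
Proof. by move=> hM; have := oriented_anti hM u u; lia. Qed.

(** The diamond rule at [u = v] says that the square of this entry is 1, and positivity selects the
    root. *)
Lemma oriented_succ (M : int -> int -> int) (u : int) :
  oriented_frieze M -> M u (u + 1) = 1.
Proof.
move=> hM; have := oriented_diamond hM u u.
rewrite !(oriented_diag _ hM) (oriented_anti hM u).
have : 0 < M u (u + 1) by apply: oriented_gt0 => //; lia.
by nia.
Qed.

Lemma unorient_frieze (M : int -> int -> int) :
  oriented_frieze M -> infinite_frieze (unorient M).
Proof.
move=> hM; rewrite /unorient; split=> [i | i | i j le_ij | i j _].
- by rewrite (_ : i - 2 + 1 = i - 1) ?(oriented_diag _ hM) //; lia.
- by rewrite -[RHS](oriented_succ (i - 1) hM).
- by apply: oriented_gt0 => //; lia.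
rewrite -[RHS](oriented_diamond hM (i - 1) (j + 1)).
by rewrite (_ : i + 1 - 1 = i - 1 + 1) //; lia.
Qed.

(** [g] stands for one linear coordinate of the vectors [x_u]. *)
Definition insert_sum (k : int) (g : int -> int) (u : int) : int :=
  if u <= k then g u
  else if u == k + 1 then g k + g (k + 1)
  else g (u - 1).

Lemma insert_sum_le (k u : int) (g : int -> int) :
  u <= k -> insert_sum k g u = g u.
Proof. by rewrite /insert_sum => ->. Qed.

Lemma insert_sum_succ (k : int) (g : int -> int) :
  insert_sum k g (k + 1) = g k + g (k + 1).
Proof. by rewrite /insert_sum eqxx ifF //; lia. Qed.

Lemma insert_sum_gt (k u : int) (g : int -> int) :
  k + 1 < u -> insert_sum k g u = g (u - 1).
Proof. by move=> lt_ku; rewrite /insert_sum !ifF //; lia. Qed.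

(* Replacing one of two vectors by their sum does not change their
   determinant. *)
Lemma insert_sum_det (k u : int) : exists x : int, forall g h : int -> int,
  insert_sum k g u * insert_sum k h (u + 1)
  - insert_sum k g (u + 1) * insert_sum k h u
  = g x * h (x + 1) - g (x + 1) * h x.
Proof.
have [lt_uk | lt_ku | ->] := ltgtP u k.
- by exists u => g h; rewrite !insert_sum_le //; lia.
- have [-> | neq_uk] := eqVneq u (k + 1).
    by exists k => g h; rewrite !insert_sum_succ !insert_sum_gt ?addrK; lia.
  by exists (u - 1) => g h; rewrite !insert_sum_gt ?addrK ?subrK //; lia.
- by exists k => g h; rewrite !insert_sum_succ !insert_sum_le //; ring.
Qed.

(** Inserting in each argument separately is what bilinearity of the determinant dictates. *)
Definition insert_vertex (k : int) (M : int -> int -> int) (u v : int) : int :=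
  insert_sum k (fun x => insert_sum k (M x) v) u.

Lemma insert_vertex_frieze (k : int) (M : int -> int -> int) :
  oriented_frieze M -> oriented_frieze (insert_vertex k M).
Proof.
move=> hM; have anti := oriented_anti hM.
(* A forward arc at the new vertex is a sum of two old arcs; one may join a vertex to itself and
   vanish, but the other is positive. *)
have ge0 u v : u <= v -> 0 <= M u v.
  rewrite le_eqVlt => /predU1P[-> | lt_uv]; first by rewrite (oriented_diag _ hM).
  by rewrite ltW ?oriented_gt0.
split=> [u v | u v lt_uv | u v].
- rewrite /insert_vertex /insert_sum.
  by do !case: ifP => _; rewrite ?opprD -!anti // addrACA.
- rewrite /insert_vertex; have [le_vk | lt_kv] := leP v k.
    by rewrite !insert_sum_le ?oriented_gt0 //; lia.
  have [v_eq | neq_vk] := eqVneq v (k + 1).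
    rewrite v_eq insert_sum_le ?insert_sum_succ; last by lia.
    by rewrite ltr_wpDl ?ge0 ?oriented_gt0 //; lia.
  have [le_uk | lt_ku] := leP u k.
    by rewrite insert_sum_le ?insert_sum_gt ?oriented_gt0 //; lia.
  have [-> | neq_uk] := eqVneq u (k + 1).
    rewrite insert_sum_succ !(@insert_sum_gt k v); try lia.
    by rewrite ltr_wpDr ?ge0 ?oriented_gt0 //; lia.
  by rewrite !insert_sum_gt ?oriented_gt0 //; lia.
(* The diamond expression is the 2 x 2 minor on rows [u, u + 1] and columns [v, v + 1]. Since [x]
   and [y] do not depend on [g] and [h], it reduces, first by rows and then by columns, to the minor
   of [M] at [x, y]. *)
have [x detx] := insert_sum_det k u; have [y dety] := insert_sum_det k v.
rewrite /insert_vertex.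
rewrite (detx (fun z => insert_sum k (M z) v)
              (fun z => insert_sum k (M z) (v + 1))).
by rewrite [X in _ - X]mulrC dety [X in _ - X]mulrC (oriented_diamond hM).
Qed.

(** Entry [i] is the arc that skips vertex [i]. For [i = k] and [i = k + 2] the new vertex [k + 1]
    is an endpoint, and its sum adds an arc of value 1 between old neighbours; for [i = k + 1] it is
    skipped, leaving the old arc from [k] to [k + 1]. *)
Lemma insert_vertex_quiddity (k i : int) (m : int -> int -> int) :
  infinite_frieze m ->
  ahat (fun i => m i i) k i
  = insert_vertex k (orient m) (i - 1) (i + 1).
Proof.
move=> hm; have skip u : orient m (u - 1) (u + 1) = m u u.
  by rewrite /orient ifT ?subrK ?addrK //; lia.
have succ u := orient_succ u hm.
rewrite /ahat /insert_vertex.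
case: (boolP (i <= k - 1)) => [le_ik | nle_ik].
  by rewrite !insert_sum_le ?skip //; lia.
have [-> | neq0] := eqVneq i k.
  rewrite insert_sum_le ?insert_sum_succ ?skip; last by lia.
  by rewrite -[X in orient m _ X](subrK 1 k) succ addrC.
have [-> | neq1] := eqVneq i (k + 1).
  by rewrite addrK insert_sum_le // insert_sum_gt ?addrK ?succ //; lia.
have [-> | neq2] := eqVneq i (k + 2).
  rewrite (_ : k + 2 = k + 1 + 1) ?addrK; last by lia.
  rewrite insert_sum_succ !insert_sum_gt ?addrK; try lia.
  by rewrite -(skip (k + 1)) addrK succ.
rewrite !insert_sum_gt; try lia.
by rewrite -(skip (i - 1)) subrK addrK.
Qed.

Theorem theorem2p1 (m : int -> int -> int) (a : int -> int) (k : int) :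
  infinite_frieze m ->
  (forall i : int, a i = quiddity_row m i) ->
  exists mhat : int -> int -> int,
    infinite_frieze mhat /\
    (forall i : int, ahat a k i = quiddity_row mhat i).
Proof.
move=> hm ha; exists (unorient (insert_vertex k (orient m))); split.
  exact/unorient_frieze/insert_vertex_frieze/orient_frieze.
move=> i; rewrite /quiddity_row /unorient -insert_vertex_quiddity //.
by rewrite /ahat !ha.
Qed.
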